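(* Let $(K_1,\leq_1)$ and $(K_2,\leq_2)$ be smooth classes in disjoint languages $\mathcal{L}_1$ and $\mathcal{L}_2$, with generics $M_1$ and $M_2$ respectively. Assume both classes are closed under substructure and have dAP. Suppose $(K_1,\leq_1)$ has smooth intersections and dPS. Let $M^*$ denote the generic of the merge $(K^*,\leq_* )=K_1\circledast K_2$. Let $\varphi(x,\overline{y})$ be an existential $\mathcal{L}_2$-formula ($x$ a single variable), let $\overline{m}$ be a finite tuple from $M^*$, and suppose that $C^*=\varphi(M^*,\overline{m})=\{c\in M^*: M^*\models\varphi(c,\overline{m})\}$ is infinite. Then $C^*|_{\mathcal{L}_1}$ (the $\mathcal{L}_1$-reduct of the substructure of $M^*$ with universe $C^*$) is isomorphic to $M_1$, the generic of $(K_1,\leq_1)$.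
   Context: All languages are countable and relational. Smooth class. A pair $(K,\leq)$ is a smooth class in the language $\mathcal{L}$ if $K$ is a class of finite $\mathcal{L}$-structures closed under isomorphism and $\leq$ is a binary relation on $K$ such that: (1) $\leq$ is transitive and $A\leq B$ implies $A\subseteq B$ (substructure); (2) for every $B\in K$ and every enumeration $\overline{b}=(b_1,\dots,b_n)$ of $B$ there is a (possibly infinite) set $\Phi_{\overline{b}}(\overline{x})$, $|\overline{x}|=n$, of universal $\mathcal{L}$-formulas containing the atomic diagram of $B$ (w.r.t. $\overline{b}$) such that for all $C\in K$ with $B\subseteq C$: $B\leq C\Leftrightarrow C\models\Phi_{\overline{b}}(\overline{b})$; (3) if $f:A\to B$ is an isomorphism of members of $K$ and $\overline{a}$ enumerates $A$, then $\Phi_{\overline{a}}=\Phi_{f(\overline{a})}$; (4) $\emptyset\in K$ and $\emptyset\leq A$ for all $A\in K$. For an $\mathcal{L}$-structure $M$ and $A\in K$ with $A\subseteq M$, write $A\leq M$ iff $M\models\Phi_{\overline{a}}(\overline{a})$ for every enumeration $\overline{a}$ of $A$. Generic. An $\mathcal{L}$-structure $M$ is a generic for $(K,\leq)$ if (1) $M=\bigcup_{i\in\omega}A_i$ with $A_i\in K$ and $A_i\leq A_j$ for $i\leq j$; and (2) whenever $A,B\in K$, $A\leq M$ and $A\leq B$, there is an embedding $f:B\to M$ with $f|_A=\mathrm{id}_A$ and $f(B)\leq M$. A generic is unique up to isomorphism. dAP (disjoint amalgamation). For all $A,B,C\in K$ and embeddings $h_1:A\to C$, $h_2:A\to B$ with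 $h_1(A)\leq C$, $h_2(A)\leq B$, there are $D\in K$ and embeddings $f:B\to D$, $g:C\to D$ with $f(B)\leq D$, $g(C)\leq D$, $f\circ h_2=g\circ h_1$ and $f(B)\cap g(C)=f(h_2(A))$. dPS (disjoint parallel strongness). For all $A,B,C\in K$ with $A\subseteq C$ and $A\leq B$, there are $D\in K$ and embeddings $f:C\to D$, $g:B\to D$ with $f(C)\leq D$, $g(B)\subseteq D$, $f|_A=g|_A$ and $f(C)\cap g(B)=f(A)$. Smooth intersections. For all $A,B,C\in K$ (substructures of a common structure), $A\leq B$ implies $A\cap C\leq B\cap C$. Merge. For smooth classes $(K_i,\leq_i)$ in pairwise disjoint languages $\mathcal{L}_i$, $i\in I$, the merge $\circledast_{i\in I}K_i$ is the smooth class $(K^*,\leq_* )$ in $\mathcal{L}^*=\bigcup_i\mathcal{L}_i$, where $K^*$ is the class of finite $\mathcal{L}^*$-structures $A$ with $A|_{\mathcal{L}_i}\in K_i$ for all $i\in I$, and $A\leq_*B$ iff $A|_{\mathcal{L}_i}\leq_iB|_{\mathcal{L}_i}$ for all $i\in I$. *)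

(* Defs.v *)
From HB Require Import structures.
From mathcomp Require Import all_boot.
From mathcomp Require Import boolp classical_sets functions cardinality.

Set Implicit Arguments.
Unset Strict Implicit.
Unset Printing Implicit Defensive.

Local Open Scope classical_set_scope.

(* Arities are positive, so that there is a single empty structure. *)
Record language := Language {
  symb :> countType;
  arity : symb -> nat;
  arity_gt0 : forall r, 0 < arity r
}.

Section Formulas.
Variable L : language.

(* [formula n] has its free variables among x_0, ..., x_(n-1). A quantifier
   binds variable 0 of its body and shifts the others, see [vcons]. *)
Inductive formula : nat -> Type :=
| FFalse n : formula n
| FEq n (i j : 'I_n) : formula n
| FRel n (r : L) (t : 'I_(arity r) -> 'I_n) : formula n
| FNot n (phi : formula n) : formula n
| FAnd n (phi psi : formula n) : formula n
| FOr n (phi psi : formula n) : formula n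
| FAll n (phi : formula n.+1) : formula n
| FEx n (phi : formula n.+1) : formula n.

Fixpoint quantifier_free n (phi : formula n) : bool :=
  match phi with
  | FFalse _ | FEq _ _ _ | FRel _ _ _ => true
  | FNot _ psi => quantifier_free psi
  | FAnd _ psi chi | FOr _ psi chi => quantifier_free psi && quantifier_free chi
  | FAll _ _ | FEx _ _ => false
  end.

Fixpoint universal n (phi : formula n) : bool :=
  match phi with
  | FAll _ psi => universal psi
  | chi => quantifier_free chi
  end.

Fixpoint existential n (phi : formula n) : bool :=
  match phi with
  | FEx _ psi => existential psi
  | chi => quantifier_free chi
  end.

Definition atomic n (phi : formula n) : bool :=
  match phi with
  | FEq _ _ _ | FRel _ _ _ => true
  | _ => false
  end.

Definition literal n (phi : formula n) : bool :=
  match phi with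
  | FNot _ psi => atomic psi
  | chi => atomic chi
  end.

End Formulas.

Arguments FFalse {L n}.
Arguments FEq {L n}.
Arguments FRel {L n}.

(* Structures have their universes inside an ambient type [U], so that
   inclusions, unions and intersections of structures are the set-theoretic
   ones. The values of [interp] on tuples outside [dom] are irrelevant: every
   notion below only looks at tuples from [dom]. Likewise a map between two
   structures is a function [U -> U] considered on the domain of its source. *)
Record structure (L : language) (U : Type) := Structure {
  dom : set U;
  interp : forall r : L, ('I_(arity r) -> U) -> Prop
}.

Definition vcons (U : Type) n (a : U) (v : 'I_n -> U) : 'I_n.+1 -> U :=
  fun i => oapp v a (unlift ord0 i).

Section Structures.
Variables (L : language) (U : Type).
Implicit Types A B C D M : structure L U.

Fixpoint sat M n (phi : formula L n) : ('I_n -> U) -> Prop :=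
  match phi with
  | FFalse _ => fun=> False
  | FEq _ i j => fun v => v i = v j
  | FRel _ r t => fun v => interp M (v \o t)
  | FNot _ psi => fun v => ~ sat M psi v
  | FAnd _ psi chi => fun v => sat M psi v /\ sat M chi v
  | FOr _ psi chi => fun v => sat M psi v \/ sat M chi v
  | FAll _ psi => fun v => forall a, dom M a -> sat M psi (vcons a v)
  | FEx _ psi => fun v => exists2 a, dom M a & sat M psi (vcons a v)
  end.

Definition substructure A B : Prop :=
  dom A `<=` dom B /\
  forall (r : L) (t : 'I_(arity r) -> U),
    (forall i, dom A (t i)) -> (interp A t <-> interp B t).

Definition embedding A B (f : U -> U) : Prop :=
  [/\ set_fun (dom A) (dom B) f,
      set_inj (dom A) f &
      forall (r : L) (t : 'I_(arity r) -> U),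
        (forall i, dom A (t i)) -> (interp A t <-> interp B (f \o t))].

Definition isomorphism A B (f : U -> U) : Prop :=
  embedding A B f /\ set_surj (dom A) (dom B) f.

Definition isomorphic A B : Prop := exists f, isomorphism A B f.

(* The substructure of [B] with universe [X], meant for [X `<=` dom B]. *)
Definition induced B (X : set U) : structure L U := Structure X (@interp L U B).

(* The substructure f(A) of [B], for an embedding [f] of [A] into [B]. *)
Definition im f A B : structure L U := induced B (f @` dom A).

Definition inter A B : structure L U := induced A (dom A `&` dom B).

Definition enumerates A n (a : 'I_n -> U) : Prop := set_bij setT (dom A) a.

Definition atomic_diagram A n (a : 'I_n -> U) : set (formula L n) :=
  [set theta | literal theta /\ sat A theta a].

Definition definable_set M n (phi : formula L n.+1) (m : 'I_n -> U) : set U :=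
  [set c | dom M c /\ sat M phi (vcons c m)].

End Structures.

(* [Phi K B b] is the set of formulas attached to the enumeration [b] of [B];
   it only matters when [b] does enumerate [B]. *)
Record class_data (L : language) (U : Type) := ClassData {
  inK : structure L U -> Prop;
  leK : structure L U -> structure L U -> Prop;
  Phi : forall (B : structure L U) n, ('I_n -> U) -> set (formula L n)
}.

Section Classes.
Variables (L : language) (U : Type).
Implicit Types (K : class_data L U) (A B C D M N : structure L U).

Record smooth K : Prop := Smooth {
  smooth_finite : forall A, inK K A -> finite_set (dom A);
  smooth_iso : forall A B, inK K A -> isomorphic A B -> inK K B;
  smooth_in : forall A B, leK K A B -> inK K A /\ inK K B;
  smooth_trans : forall A B C, leK K A B -> leK K B C -> leK K A C;
  smooth_sub : forall A B, leK K A B -> substructure A B;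
  smooth_universal : forall B n (b : 'I_n -> U), inK K B -> enumerates B b ->
    forall phi, Phi K B b phi -> universal phi;
  smooth_diagram : forall B n (b : 'I_n -> U), inK K B -> enumerates B b ->
    atomic_diagram B b `<=` Phi K B b;
  smooth_le : forall B n (b : 'I_n -> U), inK K B -> enumerates B b ->
    forall C, inK K C -> substructure B C ->
    (leK K B C <-> forall phi, Phi K B b phi -> sat C phi b);
  smooth_Phi_iso : forall A B f n (a : 'I_n -> U), inK K A -> inK K B ->
    isomorphism A B f -> enumerates A a -> Phi K A a = Phi K B (f \o a);
  smooth_empty : forall E, dom E = set0 ->
    inK K E /\ forall A, inK K A -> leK K E A
}.

(* A <= M for an arbitrary structure [M]. *)
Definition strong_in K A M : Prop :=
  [/\ inK K A, substructure A M &
      forall n (a : 'I_n -> U), enumerates A a ->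
        forall phi, Phi K A a phi -> sat M phi a].

Definition generic K M : Prop :=
  (exists F : nat -> structure L U,
     [/\ forall i, inK K (F i),
         forall i j, i <= j -> leK K (F i) (F j),
         forall i, substructure (F i) M &
         dom M = \bigcup_i dom (F i)]) /\
  (forall A B, inK K A -> inK K B -> strong_in K A M -> leK K A B ->
     exists f, [/\ embedding B M f,
                   forall x, dom A x -> f x = x &
                   strong_in K (im f B M) M]).

Definition closed_under_substructure K : Prop :=
  forall A B, inK K B -> substructure A B -> inK K A.

Definition dAP K : Prop :=
  forall A B C h1 h2, inK K A -> inK K B -> inK K C ->
    embedding A C h1 -> embedding A B h2 ->
    leK K (im h1 A C) C -> leK K (im h2 A B) B ->
  exists D f g,
    [/\ inK K D, embedding B D f /\ embedding C D g,
        leK K (im f B D) D /\ leK K (im g C D) D,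
        forall x, dom A x -> f (h2 x) = g (h1 x) &
        (f @` dom B) `&` (g @` dom C) = f @` (h2 @` dom A)].

Definition dPS K : Prop :=
  forall A B C, inK K A -> inK K B -> inK K C ->
    substructure A C -> leK K A B ->
  exists D f g,
    [/\ inK K D, embedding C D f /\ embedding B D g,
        leK K (im f C D) D /\ substructure (im g B D) D,
        forall x, dom A x -> f x = g x &
        (f @` dom C) `&` (g @` dom B) = f @` dom A].

Definition smooth_intersections K : Prop :=
  forall N A B C, inK K A -> inK K B -> inK K C ->
    substructure A N -> substructure B N -> substructure C N ->
    leK K A B -> leK K (inter A C) (inter B C).

End Classes.

Section Merge.
Variables L1 L2 : language.

Definition sum_arity (r : L1 + L2) : nat :=
  match r with inl r1 => arity r1 | inr r2 => arity r2 end.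

Lemma sum_arity_gt0 r : 0 < sum_arity r.
Proof. by case: r => r; exact: arity_gt0. Qed.

(* The union of the languages, made disjoint. *)
Definition lang_sum : language := Language sum_arity_gt0.

Definition inl_symb (r : L1) : lang_sum := inl r.
Definition inr_symb (r : L2) : lang_sum := inr r.

Fixpoint liftl n (phi : formula L1 n) : formula lang_sum n :=
  match phi with
  | FFalse _ => FFalse
  | FEq _ i j => FEq i j
  | FRel _ r t => FRel (inl_symb r) t
  | FNot _ psi => FNot (liftl psi)
  | FAnd _ psi chi => FAnd (liftl psi) (liftl chi)
  | FOr _ psi chi => FOr (liftl psi) (liftl chi)
  | FAll _ psi => FAll (liftl psi)
  | FEx _ psi => FEx (liftl psi)
  end.

Fixpoint liftr n (phi : formula L2 n) : formula lang_sum n :=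
  match phi with
  | FFalse _ => FFalse
  | FEq _ i j => FEq i j
  | FRel _ r t => FRel (inr_symb r) t
  | FNot _ psi => FNot (liftr psi)
  | FAnd _ psi chi => FAnd (liftr psi) (liftr chi)
  | FOr _ psi chi => FOr (liftr psi) (liftr chi)
  | FAll _ psi => FAll (liftr psi)
  | FEx _ psi => FEx (liftr psi)
  end.

Variable U : Type.

Definition reductl (M : structure lang_sum U) : structure L1 U :=
  Structure (dom M) (fun r => @interp _ _ M (inl_symb r)).

Definition reductr (M : structure lang_sum U) : structure L2 U :=
  Structure (dom M) (fun r => @interp _ _ M (inr_symb r)).

(* For the merge, [Phi] is the union of the two sets of formulas; it defines
   the relation [leK] of the merge by [smooth_merge] below. *)
Definition merge_class (K1 : class_data L1 U) (K2 : class_data L2 U) :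
    class_data lang_sum U :=
  ClassData
    (fun A => inK K1 (reductl A) /\ inK K2 (reductr A))
    (fun A B => leK K1 (reductl A) (reductl B) /\ leK K2 (reductr A) (reductr B))
    (fun B n b => (@liftl n @` Phi K1 (reductl B) b) `|`
                  (@liftr n @` Phi K2 (reductr B) b)).

Lemma sat_liftl (M : structure lang_sum U) n (phi : formula L1 n) v :
  sat M (liftl phi) v <-> sat (reductl M) phi v.
Proof.
elim: phi v => //=.
- by move=> {}n phi IH v; rewrite IH.
- by move=> {}n phi IH psi IH' v; rewrite IH IH'.
- by move=> {}n phi IH psi IH' v; rewrite IH IH'.
- by move=> {}n phi IH v; split=> H a aM; apply/IH/H.
- by move=> {}n phi IH v; split=> -[a aM /IH H]; exists a.
Qed.

Lemma sat_liftr (M : structure lang_sum U) n (phi : formula L2 n) v :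
  sat M (liftr phi) v <-> sat (reductr M) phi v.
Proof.
elim: phi v => //=.
- by move=> {}n phi IH v; rewrite IH.
- by move=> {}n phi IH psi IH' v; rewrite IH IH'.
- by move=> {}n phi IH psi IH' v; rewrite IH IH'.
- by move=> {}n phi IH v; split=> H a aM; apply/IH/H.
- by move=> {}n phi IH v; split=> -[a aM /IH H]; exists a.
Qed.

Lemma quantifier_free_liftl n (phi : formula L1 n) :
  quantifier_free (liftl phi) = quantifier_free phi.
Proof. by elim: phi => //= {}n phi -> psi ->. Qed.

Lemma quantifier_free_liftr n (phi : formula L2 n) :
  quantifier_free (liftr phi) = quantifier_free phi.
Proof. by elim: phi => //= {}n phi -> psi ->. Qed.

Lemma universal_liftl n (phi : formula L1 n) :
  universal (liftl phi) = universal phi.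
Proof.
by elim: phi => //= {}n *; rewrite ?quantifier_free_liftl.
Qed.

Lemma universal_liftr n (phi : formula L2 n) :
  universal (liftr phi) = universal phi.
Proof.
by elim: phi => //= {}n *; rewrite ?quantifier_free_liftr.
Qed.

Lemma substructure_reduct (A B : structure lang_sum U) :
  substructure A B <->
  substructure (reductl A) (reductl B) /\ substructure (reductr A) (reductr B).
Proof.
split=> [[s h]|[[s hl] [_ hr]]]; last by split=> // -[r|r] t; [apply: hl|apply: hr].
by split; split=> // r t; [apply: (h (inl_symb r))|apply: (h (inr_symb r))].
Qed.

Lemma isomorphism_reduct (A B : structure lang_sum U) f :
  isomorphism A B f <->
  isomorphism (reductl A) (reductl B) f /\ isomorphism (reductr A) (reductr B) f.
Proof.
split=> [[[ff fi h] s]|[[[ff fi hl] s] [[_ _ hr] _]]].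
  by split; split=> //; split=> // r t;
    [apply: (h (inl_symb r))|apply: (h (inr_symb r))].
by split=> //; split=> // -[r|r] t; [apply: hl|apply: hr].
Qed.

Lemma literal_lift n (phi : formula lang_sum n) : literal phi ->
  (exists2 psi, literal psi & phi = liftl psi) \/
  (exists2 psi, literal psi & phi = liftr psi).
Proof.
have at_lift k (chi : formula lang_sum k) : atomic chi ->
    (exists2 psi, atomic psi & chi = liftl psi) \/
    (exists2 psi, atomic psi & chi = liftr psi).
  case: chi => {}k //=.
  - by move=> i j _; left; exists (FEq i j).
  - move=> [r|r] t _; first by left; exists (FRel r t).
    by right; exists (FRel r t).
case: phi => {}n //=.
- by move=> i j _; left; exists (FEq i j).
- move=> [r|r] t _; first by left; exists (FRel r t).
  by right; exists (FRel r t).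
- move=> phi /at_lift[[psi ? ->]|[psi ? ->]]; first by left; exists (FNot psi).
  by right; exists (FNot psi).
Qed.

Theorem smooth_merge (K1 : class_data L1 U) (K2 : class_data L2 U) :
  smooth K1 -> smooth K2 -> smooth (merge_class K1 K2).
Proof.
move=> S1 S2; split=> /=.
- by move=> A [/(smooth_finite S1)].
- move=> A B [A1 A2] [f /isomorphism_reduct[f1 f2]].
  by split; [apply: smooth_iso S1 _ _ A1 _|apply: smooth_iso S2 _ _ A2 _]; exists f.
- by move=> A B [/(smooth_in S1)[? ?] /(smooth_in S2)[? ?]].
- move=> A B C [AB1 AB2] [BC1 BC2].
  by split; [apply: smooth_trans AB1 BC1|apply: smooth_trans AB2 BC2].
- move=> A B [/(smooth_sub S1) ? /(smooth_sub S2) ?].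
  exact/substructure_reduct.
- move=> B n b [B1 B2] bB phi [] [psi psiP <-].
    by rewrite universal_liftl; apply: smooth_universal psiP.
  by rewrite universal_liftr; apply: smooth_universal psiP.
- move=> B n b [B1 B2] bB phi [/literal_lift[][psi lpsi ->] h].
    left; exists psi => //; apply: (smooth_diagram S1) => //.
    by split=> //; apply/sat_liftl.
  right; exists psi => //; apply: (smooth_diagram S2) => //.
  by split=> //; apply/sat_liftr.
- move=> B n b [B1 B2] bB C [C1 C2] /substructure_reduct[BC1 BC2].
  rewrite (smooth_le S1 B1 bB C1 BC1) (smooth_le S2 B2 bB C2 BC2); split.
    by move=> [h1 h2] phi [] [psi psiP <-]; [apply/sat_liftl/h1|apply/sat_liftr/h2].
  move=> h; split=> phi phiP.
    by apply/sat_liftl; apply: h; left; exists phi.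
  by apply/sat_liftr; apply: h; right; exists phi.
- move=> A B f n a [A1 A2] [B1 B2] /isomorphism_reduct[f1 f2] aA.
  by rewrite (smooth_Phi_iso S1 A1 B1 f1 aA) (smooth_Phi_iso S2 A2 B2 f2 aA).
- move=> E E0; have [E1 h1] := @smooth_empty _ _ _ S1 (reductl E) E0.
  have [E2 h2] := @smooth_empty _ _ _ S2 (reductr E) E0.
  by split=> // A [A1 A2]; split; [apply: h1|apply: h2].
Qed.

End Merge.

(* Main.v *)
Require Import Defs.
From HB Require Import structures.
From mathcomp Require Import all_boot.
From mathcomp Require Import boolp classical_sets functions cardinality.

Set Implicit Arguments.
Unset Strict Implicit.
Unset Printing Implicit Defensive.

Local Open Scope classical_set_scope.

(** Write [M] for the generic of the merge, [C] for the infinite set defined in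
    it by the existential formula, and [F 0], [F 1], ... for an increasing chain
    of finite strong subsets with union [M]. The L1-reduct of [C] is shown to be
    a generic of [K1]; generics are unique by back-and-forth
    ([generic_unique]), whence the isomorphism.

    That [C] is a union of a strong chain is due to smooth intersections: they
    turn [F i <= F j] into [F i `&` C <= F j `&` C] ([filtration_definable]).

    For the extension property ([extension_definable]), let [A] be strong in
    [C] and [A <= B] in [K1]. Choose [D = F i] containing [A] and the
    parameters. As [A] is strong in [C] but perhaps not in [M], amalgamating [B]
    with [D] over [A] says nothing about the position of [B] in [C]. Instead,
    [B] is first amalgamated with the trace [D `&` C], in which [A] is strong;
    the result [V] is then glued to [D] along that trace by parallel
    strongness, giving [E = D `|` V] with [D <= E] and [V `&` D = D `&` C]
    ([amalgam_over_trace]).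

    It remains to embed [E] strongly into the L1-reduct of [M] over [D] so that
    every new point falls in [C] ([graft]). Here the independence of the two
    languages is used. Since [C] is infinite, some [F j] has at least as many
    points of [C] outside [D] as [E] has new points, together with witnesses of
    the existential formula for them. Keep the L2-structure of [F j] and replace
    its L1-structure by one extending [E], the new points of [E] sitting on
    those points of [C]. The result is a strong extension of [D] in the merge,
    so it embeds in [M] over [D], and the formula, being existential, still
    holds at the images of those points in [M].

    If [u] is the resulting embedding of [E], then the trace of [u(E)] on [C] is
    exactly [u(V)], so [u(V)], and with it the copy of [B] inside, is strong in
    [C] by smooth intersections once more. *)

(** * Injections on sets *)

Lemma set_injP T U (X : set T) (f : T -> U) :
  set_inj X f <-> forall x y, X x -> X y -> f x = f y -> x = y.
Proof.
split=> [fi x y Xx Xy|fi x y /set_mem Xx /set_mem Xy]; last exact: fi.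
by apply: fi; exact: mem_set.
Qed.

Lemma finite_enumeration U (X : set U) : finite_set X ->
  exists n (a : 'I_n -> U), set_bij setT X a.
Proof.
elim/Ppointed: U => U in X *.
  rewrite emptyE => _.
  exists 0, (fun i : 'I_0 => match notF (ltn_ord i) with end).
  by split=> [[]|[]|].
move=> /finite_setP[n]; rewrite card_eq_sym => /card_set_bijP[f [ff fi fs]].
exists n, (f \o val); split.
- by move=> i _; apply: ff => /=.
- apply/set_injP => i j _ _ /=.
  by move/set_injP: fi => /[apply] /= e; apply/val_inj/e.
- by move=> x /fs[i /= lti <-]; exists (Ordinal lti).
Qed.

Lemma inj_into_infinite T U (X : set T) (V : set U) :
  finite_set X -> infinite_set V -> exists f, set_inj X f /\ set_fun X V f.
Proof.
elim/Ppointed: U => U in V *; first by rewrite emptyE => _ /(_ (finite_set0 _)).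
move=> Xfin /infiniteP/(card_le_trans (finite_set_countable Xfin))/pcard_leP[f].
by exists f; split; [exact: inj|exact: funS].
Qed.

Lemma injection_retraction U (X : set U) (f : U -> U) : set_inj X f ->
  exists g, forall x, X x -> g (f x) = x.
Proof.
move=> /set_injP fi.
pose P y x := (exists2 x', X x' & f x' = y) -> X x /\ f x = y.
have [g gP] : {g : U -> U & forall y, P y (g y)}.
  apply: choice => y; have [[x Xx <-]|n] := EM (exists2 x', X x' & f x' = y).
    by exists x.
  by exists y.
exists g => x Xx; have [|Xg e] := gP (f x); first by exists x.
exact: fi.
Qed.

(** What allows structures to be replaced by copies inside the ambient type:
    a finite structure can be moved so that a prescribed part of it lands in a
    prescribed place. *)
Lemma extend_injection U (X Y : set U) (f : U -> U) :
  infinite_set [set: U] -> finite_set Y -> X `<=` Y -> set_inj X f ->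
  exists g, set_inj Y g /\ forall x, X x -> g x = f x.
Proof.
move=> Uinf Yfin XY /set_injP fi.
have fXfin : finite_set (f @` X).
  by apply: finite_image; apply: sub_finite_set Yfin.
have [g [/set_injP gi gX]] :=
  inj_into_infinite Yfin (infinite_setD Uinf fXfin).
exists (fun x => if pselect (X x) then f x else g x); split.
  apply/set_injP => x y Yx Yy.
  case: pselect => Xx; case: pselect => Xy; [exact: fi| | |exact: gi].
    by move=> e; have [_ []] := gX y Yy; exists x.
  by move=> e; have [_ []] := gX x Yx; exists y.
by move=> x Xx; case: pselect.
Qed.

(** * Embeddings *)

Section Embeddings.
Variables (L : language) (U : Type).
Implicit Types (A B C N : structure L U) (X Y : set U) (f g h : U -> U).

Lemma induced_dom A : induced A (dom A) = A.
Proof. by case: A. Qed.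

Lemma substructure_refl A : substructure A A.
Proof. by split. Qed.

Lemma substructure_induced N X Y : X `<=` Y ->
  substructure (induced N X) (induced N Y).
Proof. by split. Qed.

Lemma induced_substructure N X : X `<=` dom N -> substructure (induced N X) N.
Proof. by split. Qed.

Lemma substructure_common A B N :
  substructure A N -> substructure B N -> dom A `<=` dom B -> substructure A B.
Proof.
move=> [AN hA] [BN hB] AB; split=> // r t tA.
by rewrite hA// hB// => i; apply/AB/tA.
Qed.

Lemma embedding_comp A B C f g :
  embedding A B f -> embedding B C g -> embedding A C (g \o f).
Proof.
move=> [ff /set_injP fi fr] [gf /set_injP gi gr]; split.
- by move=> x /ff /gf.
- by apply/set_injP => x y Ax Ay /= /gi e; apply/fi/e => //; apply: ff.
- by move=> r t tA; rewrite fr// gr// => i; apply/ff/tA.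
Qed.

Lemma eq_embedding A B f g : embedding A B f ->
  (forall x, dom A x -> g x = f x) -> embedding A B g.
Proof.
move=> [ff /set_injP fi fr] e; split.
- by move=> x Ax; rewrite e//; apply: ff.
- by apply/set_injP => x y Ax Ay; rewrite !e//; apply: fi.
- move=> r t tA; rewrite fr//; suff -> : f \o t = g \o t by [].
  by apply/funext => i /=; rewrite e.
Qed.

Lemma substructure_embedding A B : substructure A B <-> embedding A B id.
Proof. by split=> [[AB r]|[AB _ r]]; split. Qed.

Lemma embedding_sub A B C f :
  substructure A B -> embedding B C f -> embedding A C f.
Proof.
by move=> /substructure_embedding AB fe; exact: embedding_comp AB fe.
Qed.

Lemma embedding_widen A B C f :
  substructure B C -> embedding A B f -> embedding A C f.
Proof.
by move=> /substructure_embedding BC fe; exact: embedding_comp fe BC.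
Qed.

Lemma embedding_onto A B f : embedding A B f -> isomorphism A (im f A B) f.
Proof. by move=> [ff fi fr]; split; [split=> // x Ax; exists x|]. Qed.

Lemma embedding_restrict A B f X : embedding A B f -> X `<=` dom A ->
  isomorphism (induced A X) (induced B (f @` X)) f.
Proof.
move=> fe XA; apply: embedding_onto.
exact: embedding_sub (induced_substructure XA) fe.
Qed.

Lemma embedding_into A B f X : embedding A B f -> f @` dom A `<=` X ->
  embedding A (induced B X) f.
Proof. by move=> [ff fi fr] fX; split=> // x Ax; apply: fX; exists x. Qed.

Lemma embedding_image A B f : embedding A B f -> f @` dom A `<=` dom B.
Proof. by move=> [ff _ _] _ [x Ax <-]; apply: ff. Qed.

Lemma embedding_id A : embedding A A id.
Proof. by split. Qed.

Lemma isomorphism_image A B f : isomorphism A B f -> f @` dom A = dom B.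
Proof.
by move=> [fe fs]; apply/seteqP; split=> //; exact: embedding_image fe.
Qed.

Lemma isomorphism_inverse A B f g : isomorphism A B f ->
  (forall x, dom A x -> g (f x) = x) -> isomorphism B A g.
Proof.
move=> [[ff /set_injP fi fr] fs] gf.
have gA x : dom B x -> dom A (g x) /\ f (g x) = x.
  by move=> /fs[y Ay <-]; rewrite gf.
split; last by move=> x Ax; exists (f x); [apply: ff|apply: gf].
split.
- by move=> x /gA[].
- by apply/set_injP => x y /gA[_ {2}<-] /gA[_ {2}<-] ->.
- move=> r t tB; rewrite (fr r (g \o t)); last first.
    by move=> i; apply: (gA _ (tB i)).1.
  suff -> : f \o (g \o t) = t by [].
  by apply/funext => i /=; apply: (gA _ (tB i)).2.
Qed.

Lemma isomorphism_sym A B f : isomorphism A B f ->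
  exists g, isomorphism B A g /\ forall x, dom A x -> g (f x) = x.
Proof.
move=> fiso; have [[_ fi _] _] := fiso; have [g gf] := injection_retraction fi.
by exists g; split=> //; exact: isomorphism_inverse fiso gf.
Qed.

Lemma inclusion_isomorphism A N : substructure A N ->
  isomorphism A (induced N (dom A)) id.
Proof.
move=> /substructure_embedding AN; have := embedding_onto AN.
by rewrite /im image_id.
Qed.

Definition pullback X g A : structure L U :=
  Structure X (fun r t => interp A (g \o t)).

Lemma pullback_isomorphism X g A : set_inj X g -> g @` X = dom A ->
  isomorphism (pullback X g A) A g.
Proof.
by move=> gi e; split; [split=> // x Xx|]; rewrite -?e//=; exists x.
Qed.

(** The structure transported along [f] is the pullback along a retraction
    of [f]. *)
Lemma copy A f : set_inj (dom A) f ->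
  exists A', isomorphism A A' f /\ dom A' = f @` dom A.
Proof.
move=> fi; have [g gf] := injection_retraction fi.
exists (pullback (f @` dom A) g A); split=> //.
apply: isomorphism_inverse (pullback_isomorphism _ _) _.
- by apply/set_injP => _ _ [x Ax <-] [y Ay <-]; rewrite !gf// => ->.
- apply/seteqP; split=> [_ [_ [x Ax <-] <-]|x Ax]; first by rewrite gf.
  by exists (f x); [exists x|rewrite gf].
- by move=> _ [x Ax <-]; rewrite gf.
Qed.

End Embeddings.

(** * Satisfaction *)

Section Satisfaction.
Variables (L : language) (U : Type).
Implicit Types (A B C M N : structure L U).

Lemma vcons_comp n (f : U -> U) a (v : 'I_n -> U) :
  f \o vcons a v = vcons (f a) (f \o v).
Proof. by apply/funext => i; rewrite /vcons /=; case: (unlift ord0 i). Qed.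

Lemma vcons_in n (X : set U) a (v : 'I_n -> U) :
  X a -> (forall i, X (v i)) -> forall i, X (vcons a v i).
Proof. by move=> Xa Xv i; rewrite /vcons; case: (unlift ord0 i). Qed.

Lemma sat_isomorphism A B f : isomorphism A B f ->
  forall n (phi : formula L n) v, (forall i, dom A (v i)) ->
  sat A phi v <-> sat B phi (f \o v).
Proof.
move=> [[ff /set_injP fi fr] fs] n; elim=> {n} //=.
- by move=> n i j v vA; split=> [->//|]; apply: fi.
- by move=> n r t v vA; apply: fr => i; apply: vA.
- by move=> n phi IH v vA; rewrite IH.
- by move=> n phi IH psi IH' v vA; rewrite IH// IH'.
- by move=> n phi IH psi IH' v vA; rewrite IH// IH'.
- move=> n phi IH v vA; split=> H a.
    move=> /fs[b Ab <-]; rewrite -vcons_comp -IH; first exact: H.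
    exact: vcons_in.
  move=> Aa; rewrite IH; last exact: vcons_in.
  by rewrite vcons_comp; apply/H/ff.
- move=> n phi IH v vA; split=> -[a].
    move=> Aa; rewrite IH; last exact: vcons_in.
    by rewrite vcons_comp => ?; exists (f a) => //; apply: ff.
  move=> /fs[b Ab <-]; rewrite -vcons_comp -IH; last exact: vcons_in.
  by exists b.
Qed.

Lemma sat_quantifier_free A B n (phi : formula L n) v :
  substructure A B -> quantifier_free phi -> (forall i, dom A (v i)) ->
  sat A phi v <-> sat B phi v.
Proof.
move=> [AB r]; elim: phi v => {n} //=.
- by move=> n s t v _ vA; apply: r => i; apply: vA.
- by move=> n phi IH v q vA; rewrite IH.
- by move=> n phi IH psi IH' v /andP[q q'] vA; rewrite IH// IH'.
- by move=> n phi IH psi IH' v /andP[q q'] vA; rewrite IH// IH'.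
Qed.

Lemma sat_universal_down A B n (phi : formula L n) v :
  substructure A B -> universal phi -> (forall i, dom A (v i)) ->
  sat B phi v -> sat A phi v.
Proof.
move=> AB; elim: phi v => {n};
  try by move=> *; apply/(sat_quantifier_free AB).
move=> n phi IH v /= u vA H a Aa; apply: IH => //; first exact: vcons_in.
by apply: H; apply: AB.1.
Qed.

Lemma sat_existential_up A B n (phi : formula L n) v :
  substructure A B -> existential phi -> (forall i, dom A (v i)) ->
  sat A phi v -> sat B phi v.
Proof.
move=> AB; elim: phi v => {n};
  try by move=> *; apply/(sat_quantifier_free AB).
move=> n phi IH v /= u vA [a Aa H]; exists a; first exact: AB.1.
by apply: IH => //; exact: vcons_in.
Qed.

Section Union.
Variables (M : structure L U) (X : nat -> set U).
Hypothesis Xmono : forall i j, i <= j -> X i `<=` X j.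
Hypothesis XM : dom M = \bigcup_i X i.

Lemma union_sub i : substructure (induced M (X i)) M.
Proof. by apply: induced_substructure; rewrite XM => x Xx; exists i. Qed.

Lemma union_finite Y : finite_set Y -> Y `<=` dom M -> exists i, Y `<=` X i.
Proof.
move=> /finite_enumeration[n [a [aY _ Ya]]] YM.
have [k kP] : {k : 'I_n -> nat & forall i, X (k i) (a i)}.
  apply: (@choice _ _ (fun i j => X j (a i))) => i.
  by have := YM _ (aY i I); rewrite XM => -[j _ Xj]; exists j.
exists (\max_i k i) => _ /Ya[i _ <-].
exact: Xmono (leq_bigmax i) _ (kP i).
Qed.

(** A counterexample to a universal formula in the union already occurs in a
    member of the chain. *)
Lemma sat_universal_union n (phi : formula L n) v i :
  universal phi -> (forall k, X i (v k)) ->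
  (forall j, i <= j -> sat (induced M (X j)) phi v) -> sat M phi v.
Proof.
have q k (psi : formula L k) w j : quantifier_free psi ->
    (forall l, X j (w l)) ->
    (forall l, j <= l -> sat (induced M (X l)) psi w) -> sat M psi w.
  move=> qf wX H; apply/(sat_quantifier_free (union_sub j)) => //.
  exact: H (leqnn j).
elim: phi v i => {n}; try by intros; eapply q; eassumption.
move=> n phi IH v i /= u vX H a; rewrite XM => -[k _ Xa].
apply: (IH _ (maxn i k)) => //.
  apply: vcons_in => [|l]; first exact: Xmono (leq_maxr _ _) _ Xa.
  exact: Xmono (leq_maxl _ _) _ (vX l).
move=> j; rewrite geq_max => /andP[ij kj]; apply: H => //.
exact: Xmono kj _ Xa.
Qed.

Lemma sat_existential_union n (phi : formula L n) v i :
  existential phi -> (forall k, X i (v k)) -> sat M phi v ->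
  exists2 j, i <= j & sat (induced M (X j)) phi v.
Proof.
have q k (psi : formula L k) w j : quantifier_free psi ->
    (forall l, X j (w l)) -> sat M psi w ->
    exists2 l, j <= l & sat (induced M (X l)) psi w.
  by move=> qf wX H; exists j => //; apply/(sat_quantifier_free (union_sub j)).
elim: phi v i => {n}; try by intros; eapply q; eassumption.
move=> n phi IH v i /= u vX [a]; rewrite XM => -[k _ Xa].
move=> /(IH _ (maxn i k) u)[|j].
  apply: vcons_in => [|l]; first exact: Xmono (leq_maxr _ _) _ Xa.
  exact: Xmono (leq_maxl _ _) _ (vX l).
rewrite geq_max => /andP[ij kj] H; exists j => //; exists a => //.
exact: Xmono kj _ Xa.
Qed.

End Union.
End Satisfaction.

(** * Strong substructures *)

Lemma enumerates_in L U (A : structure L U) n (a : 'I_n -> U) i :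
  enumerates A a -> dom A (a i).
Proof. by case=> aA _ _; exact: aA. Qed.

Section StrongSubstructures.
Variables (L : language) (U : Type) (K : class_data L U).
Hypothesis Ksm : smooth K.
Implicit Types (A B C M N : structure L U) (X Y Z : set U) (f g : U -> U).

Lemma leK_sat A B n (a : 'I_n -> U) psi :
  leK K A B -> enumerates A a -> Phi K A a psi -> sat B psi a.
Proof.
move=> AB aA; have [AK BK] := smooth_in Ksm AB.
by have [h _] := smooth_le Ksm AK aA BK (smooth_sub Ksm AB); exact: h.
Qed.

(** The relation [leK] is invariant under isomorphism because it is the
    satisfaction of [Phi], which is itself attached to isomorphism types. With
    the identity as isomorphism, this also shows that [leK] does not see the
    values of [interp] outside the domains. *)
Lemma leK_isomorphism A B A' B' f : leK K A B ->
  isomorphism A A' f -> isomorphism B B' f -> substructure A' B' ->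
  leK K A' B'.
Proof.
move=> AB fA fB AB'; have [AK BK] := smooth_in Ksm AB.
have A'K : inK K A' by apply: smooth_iso Ksm _ _ AK _; exists f.
have B'K : inK K B' by apply: smooth_iso Ksm _ _ BK _; exists f.
have [n [a aA]] := finite_enumeration (smooth_finite Ksm AK).
have faA : enumerates A' (f \o a).
  by have [[ff fi _] fs] := fA; apply: set_bij_comp aA _; split.
apply/(smooth_le Ksm A'K faA B'K AB').
rewrite -(smooth_Phi_iso Ksm AK A'K fA aA) => psi aPhi.
apply/(sat_isomorphism fB) => [i|].
  by apply: (smooth_sub Ksm AB).1; exact: enumerates_in aA.
exact: leK_sat AB aA aPhi.
Qed.

Lemma inK_isomorphism A B f : isomorphism A B f -> inK K A -> inK K B.
Proof. by move=> fAB AK; apply: smooth_iso Ksm _ _ AK _; exists f. Qed.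

Lemma leK_induced A B N : substructure A N -> substructure B N ->
  leK K A B <-> leK K (induced N (dom A)) (induced N (dom B)).
Proof.
move=> AN BN; have Aiso := inclusion_isomorphism AN.
have Biso := inclusion_isomorphism BN; split=> AB.
  apply: (leK_isomorphism AB Aiso Biso).
  exact/substructure_induced/(smooth_sub Ksm AB).1.
have AB' := (smooth_sub Ksm AB).1.
by apply: leK_isomorphism AB _ _ (substructure_common AN BN AB');
  [apply: isomorphism_inverse Aiso _|apply: isomorphism_inverse Biso _].
Qed.

Lemma leK_embedding N N' f X Y : embedding N N' f -> Y `<=` dom N ->
  leK K (induced N X) (induced N Y) ->
  leK K (induced N' (f @` X)) (induced N' (f @` Y)).
Proof.
move=> fe YN XY; have XsubY := (smooth_sub Ksm XY).1.
apply: (leK_isomorphism XY (embedding_restrict fe _)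
  (embedding_restrict fe _)) => //.
  exact: subset_trans YN.
exact/substructure_induced/image_subset.
Qed.

(** Universal formulas are inherited by substructures. *)
Lemma leK_down A B C : leK K A C -> inK K B -> substructure A B ->
  substructure B C -> leK K A B.
Proof.
move=> AC BK AB BC; have [AK CK] := smooth_in Ksm AC.
have [n [a aA]] := finite_enumeration (smooth_finite Ksm AK).
apply/(smooth_le Ksm AK aA BK AB) => psi aPhi.
apply: sat_universal_down BC _ _ _.
- exact: smooth_universal aPhi.
- by move=> i; apply: AB.1; exact: enumerates_in aA.
- exact: leK_sat AC aA aPhi.
Qed.

Lemma inK_induced N X Y : closed_under_substructure K ->
  inK K (induced N Y) -> X `<=` Y -> inK K (induced N X).
Proof. by move=> Kc YK XY; apply: Kc YK _; exact: substructure_induced. Qed.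

Lemma leK_setI N X Y Z : closed_under_substructure K ->
  smooth_intersections K -> Y `<=` dom N ->
  leK K (induced N X) (induced N Y) ->
  leK K (induced N (X `&` Z)) (induced N (Y `&` Z)).
Proof.
move=> Kc KI YN XY; have [XK YK] := smooth_in Ksm XY.
have XsubY : X `<=` Y := (smooth_sub Ksm XY).1.
have YZK : inK K (induced N (Y `&` Z)) by apply: (inK_induced Kc YK) => x [].
have := KI N _ _ _ XK YK YZK _ _ _ XY; rewrite /inter /=.
rewrite !setIA (setIidl XsubY) setIid; apply; apply: induced_substructure => //.
- exact: subset_trans YN.
- by move=> x [/YN].
Qed.

(** Strongness is expressed for subsets of [M] rather than for structures, so
    that equal subsets can be rewritten. *)
Definition strong M X := strong_in K (induced M X) M.

Lemma strong_sub M X : strong M X -> X `<=` dom M.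
Proof. by case=> _ []. Qed.

Lemma strong_in_induced A M : strong_in K A M -> strong M (dom A).
Proof.
move=> [AK AM PhiA]; have Aiso := inclusion_isomorphism AM.
have A'K := inK_isomorphism Aiso AK.
split=> //; first exact: induced_substructure AM.1.
move=> n a aA; have := smooth_Phi_iso Ksm AK A'K Aiso aA.
by rewrite (_ : id \o a = a)// => <-; exact: PhiA.
Qed.

Lemma strong_le M X Y : strong M X -> X `<=` Y -> Y `<=` dom M ->
  inK K (induced M Y) -> leK K (induced M X) (induced M Y).
Proof.
move=> [XK XM PhiX] XY YM YK.
have [n [a aX]] := finite_enumeration (smooth_finite Ksm XK).
apply/(smooth_le Ksm XK aX YK) => // psi aPhi.
apply: sat_universal_down (induced_substructure YM) _ _ _.
- exact: smooth_universal aPhi.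
- by move=> i; apply: XY; exact: enumerates_in aX.
- exact: PhiX aPhi.
Qed.

(** The first half of genericity, with subsets of [M] in place of finite
    structures. *)
Definition filtration M (F : nat -> set U) :=
  (forall i j, i <= j -> leK K (induced M (F i)) (induced M (F j))) /\
  dom M = \bigcup_i F i.

Lemma generic_filtration M : generic K M -> exists F, filtration M F.
Proof.
move=> [[F [FK Fle FM Fcup]] _]; exists (fun i => dom (F i)); split=> // i j ij.
by apply/(leK_induced (FM i) (FM j)); exact: Fle.
Qed.

Section Filtration.
Variables (M : structure L U) (F : nat -> set U).
Hypothesis FM : filtration M F.

Lemma filtration_mono i j : i <= j -> F i `<=` F j.
Proof. by move=> /FM.1 /(smooth_sub Ksm)[]. Qed.

Lemma filtration_sub i : F i `<=` dom M.
Proof. by rewrite FM.2 => x Fx; exists i. Qed.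

Lemma filtration_inK i : inK K (induced M (F i)).
Proof. exact: (smooth_in Ksm (FM.1 i i (leqnn i))).1. Qed.

Lemma filtration_finite X : finite_set X -> X `<=` dom M ->
  exists i, X `<=` F i.
Proof. exact: union_finite filtration_mono FM.2 X. Qed.

(** By transitivity [X] is strong in all later members of the chain, and
    universal formulas that hold in cofinally many members hold in [M]. *)
Lemma strong_filtration X i :
  leK K (induced M X) (induced M (F i)) -> strong M X.
Proof.
move=> XF; have [XK _] := smooth_in Ksm XF.
have XFi : X `<=` F i := (smooth_sub Ksm XF).1.
split=> //.
  by apply: induced_substructure; apply: subset_trans (@filtration_sub i).
move=> n a aX psi aPhi.
apply: (sat_universal_union filtration_mono FM.2) (i) _ _ _.
- exact: smooth_universal aPhi.
- by move=> k; apply: XFi; exact: enumerates_in aX.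
- move=> j ij; apply: leK_sat aX aPhi.
  exact: smooth_trans Ksm _ _ _ XF (FM.1 i j ij).
Qed.

Lemma strong_le_filtration X : strong M X ->
  exists i, X `<=` F i /\ leK K (induced M X) (induced M (F i)).
Proof.
move=> Xs; have [XK _ _] := Xs.
have [i XF] := filtration_finite (smooth_finite Ksm XK) (strong_sub Xs).
exists i; split=> //.
by apply: strong_le => //; [exact: filtration_sub|exact: filtration_inK].
Qed.

End Filtration.

Lemma strong_in_strong A M :
  substructure A M -> strong M (dom A) -> strong_in K A M.
Proof.
move=> AM [A'K _ PhiA]; have Aiso := inclusion_isomorphism AM.
have AK : inK K A.
  by apply: (inK_isomorphism (isomorphism_inverse Aiso (fun _ _ => erefl)) A'K).
split=> // n a aA; have := smooth_Phi_iso Ksm AK A'K Aiso aA.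
by rewrite (_ : id \o a = a)// => ->; exact: PhiA.
Qed.

(** The second half of genericity, with the image as a strong subset. *)
Definition extension_property M := forall A B, strong_in K A M -> leK K A B ->
  exists f, [/\ embedding B M f, forall x, dom A x -> f x = x &
                strong M (f @` dom B)].

Lemma generic_extension M : generic K M -> extension_property M.
Proof.
move=> [_ Mext] A B AM AB; have [AK BK] := smooth_in Ksm AB.
by have [f [fe fA fB]] := Mext A B AK BK AM AB; exists f.
Qed.

Hypothesis Uinf : infinite_set [set: U].

(** The extension property along an embedding instead of an inclusion: replace
    [B] by a copy in which the image of [A] under [f] sits as a subset. *)
Lemma extend_along A B N f : extension_property N -> leK K A B ->
  embedding A N f -> strong N (f @` dom A) ->
  exists g, [/\ embedding B N g, forall x, dom A x -> g x = f x &
                strong N (g @` dom B)].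
Proof.
move=> Next AB fe fA; have [_ BK] := smooth_in Ksm AB.
have AsubB := smooth_sub Ksm AB; have [_ fi _] := fe.
have [f' [f'i f'f]] := extend_injection Uinf (smooth_finite Ksm BK) AsubB.1 fi.
have [B' [Biso B'E]] := copy f'i.
have f'A : f' @` dom A = f @` dom A by apply: eq_imagel.
pose A' := induced B' (f @` dom A).
have A'B' : substructure A' B'.
  apply: induced_substructure; rewrite B'E -f'A.
  by apply: image_subset; exact: AsubB.1.
have Aiso : isomorphism A A' f'.
  by have := embedding_onto (embedding_sub AsubB Biso.1); rewrite /im f'A.
have A'le : leK K A' B' := leK_isomorphism AB Aiso Biso A'B'.
have A'N : substructure A' N.
  have [h [[hA _] hf]] := isomorphism_sym Aiso.
  apply/substructure_embedding/(eq_embedding (embedding_comp hA fe)).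
  by move=> _ /= [x Ax <-]; rewrite -{2}f'f// hf.
have [e [ee eA eB]] := Next A' B' (strong_in_strong A'N fA) A'le.
exists (e \o f'); split.
- exact: embedding_comp Biso.1 ee.
- by move=> x Ax /=; rewrite f'f// eA//; exists x.
- by rewrite -image_comp -B'E.
Qed.

(** The positions of the back-and-forth game: finite partial isomorphisms with
    strong domain and strong image. *)
Definition partial M N X f :=
  [/\ strong M X, embedding (induced M X) N f & strong N (f @` X)].

Lemma partial_inverse M N X f : partial M N X f ->
  exists g, partial N M (f @` X) g /\ forall x, X x -> g (f x) = x.
Proof.
move=> [XM fe fX]; have [_ fi _] := fe; have [g gf] := injection_retraction fi.
exists g; split=> //.
have gfX : g @` (f @` X) = X.
  rewrite image_comp -[RHS]image_id; exact: eq_imagel.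
split; rewrite ?gfX//.
apply: embedding_widen (induced_substructure (strong_sub XM)) _.
by have [] := isomorphism_inverse (embedding_onto fe) gf.
Qed.

Lemma partial_forth M N F X f i : filtration M F -> extension_property N ->
  partial M N X f ->
  exists X' g, [/\ partial M N X' g, X `<=` X', F i `<=` X' &
                   forall x, X x -> g x = f x].
Proof.
move=> FM Next [XM fe fX].
have [j [XFj _]] := strong_le_filtration FM XM.
pose k := maxn i j.
have XF : X `<=` F k := subset_trans XFj (filtration_mono FM (leq_maxr i j)).
have XFle : leK K (induced M X) (induced M (F k)).
  by apply: strong_le => //; [exact: filtration_sub|exact: filtration_inK].
have [g [ge gf gF]] := extend_along Next XFle fe fX.
exists (F k), g; split=> //; last exact: (filtration_mono FM (leq_maxl i j)).
split=> //; apply: (strong_filtration FM (i := k)); exact: FM.1.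
Qed.

(** The forth step for the inverse partial isomorphism. *)
Lemma partial_back M N G X f i : filtration N G -> extension_property M ->
  partial M N X f ->
  exists X' g, [/\ partial M N X' g, X `<=` X', G i `<=` g @` X' &
                   forall x, X x -> g x = f x].
Proof.
move=> GN Mext pf; have [g [pg gf]] := partial_inverse pf.
have [Y [g' [pg' XY GY g'g]]] := partial_forth i GN Mext pg.
have [f' [pf' f'g']] := partial_inverse pg'.
have fX x : X x -> (f @` X) (f x) by exists x.
exists (g' @` Y), f'; split=> //.
- move=> x Xx; exists (f x); first exact/XY/fX.
  by rewrite g'g ?gf//; exact: fX.
- by move=> y /GY Yy; exists (g' y); [exists y|apply: f'g'].
- move=> x Xx; rewrite -{1}(gf x Xx) -g'g; last exact: fX.
  by rewrite f'g'//; exact/XY/fX.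
Qed.

Lemma embedding_union M N (F : nat -> set U) f :
  (forall i j, i <= j -> F i `<=` F j) -> dom M = \bigcup_i F i ->
  (forall i, embedding (induced M (F i)) N f) -> embedding M N f.
Proof.
move=> Fmono MF fe; split.
- by move=> x; rewrite MF => -[i _ Fx]; have [ff _ _] := fe i; exact: ff.
- apply/set_injP => x y; rewrite MF => -[i _ Fx] [j _ Fy].
  have [_ /set_injP fi _] := fe (maxn i j).
  apply: fi; first by apply: Fmono Fx; exact: leq_maxl.
  by apply: Fmono Fy; exact: leq_maxr.
- move=> r t tM; have [i tF] : exists i, range t `<=` F i.
    apply: (union_finite Fmono MF); first exact/finite_image/finite_finset.
    by move=> _ [k _ <-].
  by have [_ _ fr] := fe i; apply: fr => k; apply: tF; exists k.
Qed.

Lemma strong_empty M F : filtration M F -> strong M set0.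
Proof.
move=> FM; have [_ le0] := smooth_empty Ksm (erefl (dom (induced M set0))).
exact/(strong_filtration FM)/le0/(filtration_inK FM 0).
Qed.

(** Back-and-forth: position [i.+1] contains [F i] in its domain and [G i] in
    its image, so that the union of the positions is an isomorphism. *)
Theorem generic_unique M N F G :
  filtration M F -> extension_property M ->
  filtration N G -> extension_property N -> isomorphic M N.
Proof.
move=> FM Mext GN Next.
pose S := {p : set U * (U -> U) | partial M N p.1 p.2}.
pose extends i (p q : S) := [/\ (sval p).1 `<=` (sval q).1,
  F i `<=` (sval q).1, G i `<=` (sval q).2 @` (sval q).1 &
  forall x, (sval p).1 x -> (sval q).2 x = (sval p).2 x].
have next i : {s : S -> S & forall p, extends i p (s p)}.
  apply: (@choice _ _ (extends i)) => -[[X f] /= pf].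
  have [Y [g [pg XY FY gf]]] := partial_forth i FM Next pf.
  have [Z [h [ph YZ GZ hg]]] := partial_back i GN Mext pg.
  exists (exist _ (Z, h) ph); split=> //=.
  - exact: subset_trans YZ.
  - exact: subset_trans YZ.
  - by move=> x Xx; rewrite hg ?gf//; exact: XY.
have p0 : partial M N set0 id.
  split; rewrite ?image_id; [exact: strong_empty FM| |exact: strong_empty GN].
  by split=> // r t t0; case: (t0 (Ordinal (arity_gt0 r))).
pose p := fix p i : S :=
  if i is j.+1 then projT1 (next j) (p j) else exist _ (set0, id) p0.
pose X i := (sval (p i)).1; pose f i := (sval (p i)).2.
have pS i : extends i (p i) (p i.+1) := projT2 (next i) (p i).
have grow i j : i <= j -> X i `<=` X j /\ forall x, X i x -> f j x = f i x.
  elim: j => [|j IH]; first by rewrite leqn0 => /eqP ->; split.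
  rewrite leq_eqVlt => /orP[/eqP ->|/IH[Xij fij]]; first by split.
  have [Xj _ _ fj] := pS j; split; first exact: subset_trans Xj.
  by move=> x Xx; rewrite -fij//; exact/fj/Xij.
(* [g] is the union of the partial maps [f i]; it is the identity off [M]. *)
have [g gP] : {g : U -> U & forall x i, X i x -> f i x = g x}.
  apply: (@choice _ _ (fun x y => forall i, X i x -> f i x = y)) => x.
  have [[i Xi]|nX] := EM (exists i, X i x); last first.
    by exists x => i Xi; case: nX; exists i.
  exists (f i x) => j Xj.
  by have [/grow[_ ->]|/ltnW/grow[_ ->]] := leqP i j.
have pP i : partial M N (X i) (f i) := svalP (p i).
have XE : dom M = \bigcup_i X i.
  apply/seteqP; split=> x.
    rewrite FM.2 => -[i _ Fx]; exists i.+1 => //.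
    by have [_ h _ _] := pS i; exact: h.
  by move=> [i _]; have [XM _ _] := pP i; exact: strong_sub.
exists g; split; last first.
  move=> y; rewrite GN.2 => -[i _ Gy]; have [_ _ h _] := pS i.
  have [x Xx <-] := h y Gy; exists x; last by rewrite -(gP x i.+1).
  by rewrite XE; exists i.+1.
apply: embedding_union XE _ => [i j /grow[]//|i].
have [_ fe _] := pP i; apply: eq_embedding fe _ => x Xx.
by rewrite (gP x i).
Qed.

End StrongSubstructures.

(** * Amalgamation *)

Section Amalgamation.
Variables (L : language) (U : Type) (K : class_data L U).
Hypothesis Ksm : smooth K.
Hypothesis Uinf : infinite_set [set: U].
Implicit Types (A B C D E M N : structure L U) (f g : U -> U).

Lemma leK_fixing A B B' f : leK K A B -> isomorphism B B' f ->
  (forall x, dom A x -> f x = x) -> leK K A B'.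
Proof.
move=> AB fB fA; have AsubB := smooth_sub Ksm AB.
have fiso : isomorphism A A f.
  split; first exact: eq_embedding (embedding_id A) fA.
  by move=> x Ax; exists x => //; exact: fA.
apply: (leK_isomorphism Ksm AB fiso fB).
apply/substructure_embedding/(eq_embedding (embedding_sub AsubB fB.1)) => x Ax.
by rewrite fA.
Qed.

(** This form fits the images [im f A B] in the amalgamation properties. *)
Lemma leK_whole A B :
  leK K A B <-> leK K (induced B (dom A)) B /\ substructure A B.
Proof.
split=> [AB|[AB AsubB]].
  have AsubB := smooth_sub Ksm AB; split=> //; move: AB.
  by rewrite (leK_induced Ksm AsubB (substructure_refl B)) induced_dom.
by rewrite (leK_induced Ksm AsubB (substructure_refl B)) induced_dom.
Qed.

(** Amalgams come with embeddings of both sides; renaming the points of the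
    amalgam makes one of the two an inclusion. *)
Lemma rebase A B C D f g :
  dom A `<=` dom C -> embedding C D f -> leK K (im f C D) D ->
  (forall x, dom A x -> f x = g x) ->
  set_fun (dom B) (dom D) g ->
  (f @` dom C) `&` (g @` dom B) = f @` dom A ->
  exists D' s, [/\ isomorphism D D' s, leK K C D',
                   forall x, dom A x -> s (g x) = x &
                   (s \o g) @` dom B `&` dom C = dom A].
Proof.
move=> AC fe fD fgA gD fgI; have [ff fi _] := fe.
have [h hf] := injection_retraction fi.
have hi : set_inj (f @` dom C) h.
  by apply/set_injP => _ _ [x Cx <-] [y Cy <-]; rewrite !hf// => ->.
have Dfin := smooth_finite Ksm (smooth_in Ksm fD).2.
have [s [si sh]] := extend_injection Uinf Dfin (embedding_image fe) hi.
have sf x : dom C x -> s (f x) = x by move=> Cx; rewrite sh ?hf//; exists x.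
have [D' [sD D'E]] := copy si.
exists D', s; split=> //.
- apply: (leK_isomorphism Ksm fD _ sD).
    exact: isomorphism_inverse (embedding_onto fe) sf.
  apply/substructure_embedding/(eq_embedding (embedding_comp fe sD.1)) => x Cx.
  by rewrite /= sf.
- by move=> x Ax; rewrite -fgA// sf//; exact: AC.
- apply/seteqP; split=> x.
    move=> [[b Bb /= sgb] Cx].
    have fxgb : f x = g b.
      move/set_injP: si; apply; [exact: ff|exact: gD|by rewrite sf].
    have : (f @` dom A) (f x) by rewrite -fgI; split; [exists x|exists b].
    by move=> [a Aa fafx]; rewrite -(sf x Cx) -fafx sf//; exact: AC.
  move=> Ax; split; last exact: AC.
  have : ((f @` dom C) `&` (g @` dom B)) (f x) by rewrite fgI; exists x.
  by move=> [_ [b Bb gb]]; exists b => //=; rewrite gb sf//; exact: AC.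
Qed.

Lemma disjoint_amalgam A B C : dAP K -> leK K A B -> leK K A C ->
  exists D p, [/\ leK K C D, embedding B D p,
                  leK K (induced D (p @` dom B)) D,
                  forall x, dom A x -> p x = x &
                  (p @` dom B) `&` dom C = dom A].
Proof.
move=> KAP AB AC.
have [AK BK] := smooth_in Ksm AB; have [_ CK] := smooth_in Ksm AC.
have AsubB := smooth_sub Ksm AB; have AsubC := smooth_sub Ksm AC.
have [||||D [f [g [DK [fe ge] [fD gD] fgA fgI]]]] := KAP A B C id id AK BK CK.
- exact/substructure_embedding.
- exact/substructure_embedding.
- by rewrite /im image_id; exact: ((leK_whole _ _).1 AC).1.
- by rewrite /im image_id; exact: ((leK_whole _ _).1 AB).1.
have [D' [s [sD CD' sgA sgI]]] :
    exists D' s, [/\ isomorphism D D' s, leK K C D',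
      forall x, dom A x -> s (f x) = x & (s \o f) @` dom B `&` dom C = dom A].
  apply: (@rebase A B C D g f) => //.
  - exact: AsubC.1.
  - by move=> x Ax; rewrite -fgA.
  - by have [] := fe.
  - rewrite setIC fgI image_id; apply: eq_imagel => x Ax; exact: fgA.
exists D', (s \o f); split=> //; first exact: embedding_comp fe sD.1.
have := leK_embedding (X := f @` dom B) (Y := dom D) Ksm sD.1 (subset_refl _).
rewrite !induced_dom image_comp (isomorphism_image sD) induced_dom; exact.
Qed.

Lemma disjoint_parallel A B C : dPS K -> substructure A C -> inK K C ->
  leK K A B ->
  exists D g, [/\ leK K C D, embedding B D g, forall x, dom A x -> g x = x &
                  (g @` dom B) `&` dom C = dom A].
Proof.
move=> KPS AC CK AB; have [AK BK] := smooth_in Ksm AB.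
have [D [f [g [DK [fe ge] [fD gD] fgA fgI]]]] := KPS A B C AK BK CK AC AB.
have [|D' [s [sD CD' sgA sgI]]] := rebase AC.1 fe fD fgA _ fgI.
  by have [] := ge.
by exists D', (s \o g); split=> //; exact: embedding_comp ge sD.1.
Qed.

(** [A] is strong only in the part [X] of [D]. The set [V] is the amalgam over
    [A] of [B] and [X], attached to [D] along [X] by parallel strongness, which
    asks only that [X] be a substructure of [D]; cutting down to the union of
    [D] and [V] keeps [D] strong. *)
Lemma amalgam_over_trace A B D X : closed_under_substructure K ->
  dAP K -> dPS K -> inK K D -> X `<=` dom D ->
  leK K A (induced D X) -> leK K A B ->
  exists E g V, [/\ leK K D E, embedding B E g, forall x, dom A x -> g x = x,
    leK K (induced E (g @` dom B)) (induced E V) &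
    V `&` dom D = X /\ dom E = dom D `|` V].
Proof.
move=> Kc KAP KPS DK XD AX AB.
have [P [p [XP pe pP pA _]]] := disjoint_amalgam KAP AB AX.
have [E [q [DE qe qX qI]]] :=
  disjoint_parallel KPS (induced_substructure XD) DK XP.
pose V := q @` dom P; pose E' := induced E (dom D `|` V).
have DsubE := smooth_sub Ksm DE.
have E'sub : dom D `|` V `<=` dom E.
  by move=> x [/DsubE.1//|]; exact: embedding_image qe x.
have AsubX : dom A `<=` X := (smooth_sub Ksm AX).1.
exists E', (q \o p), V; split=> //.
- apply: (leK_down Ksm DE); last exact: induced_substructure.
    exact: Kc (smooth_in Ksm DE).2 (induced_substructure E'sub).
  apply: substructure_common DsubE (induced_substructure E'sub) _.
  exact: subsetUl.
- apply: embedding_into; first exact: embedding_comp pe qe.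
  rewrite -image_comp => x [y /(embedding_image pe) Py <-].
  by right; exists y.
- by move=> x Ax /=; rewrite pA// qX//; exact: AsubX.
- have := leK_embedding (X := p @` dom B) (Y := dom P) Ksm qe (subset_refl _).
  by rewrite induced_dom image_comp; exact.
Qed.

End Amalgamation.

(** * Definable sets in the generic of a merge *)

(** Meant for [A] and [B] with the same domain. *)
Definition superpose (L1 L2 : language) (U : Type)
    (A : structure L1 U) (B : structure L2 U) : structure (lang_sum L1 L2) U :=
  Structure (L := lang_sum L1 L2) (dom B)
    (fun r : L1 + L2 => match r return ('I_(sum_arity r) -> U) -> Prop with
      | inl r1 => @interp _ _ A r1
      | inr r2 => @interp _ _ B r2
      end).

Section DefinableSet.
Variables (L1 L2 : language) (U : Type).
Variables (K1 : class_data L1 U) (K2 : class_data L2 U).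
Hypotheses (K1sm : smooth K1) (K2sm : smooth K2).
Variables (M : structure (lang_sum L1 L2) U) (F : nat -> set U).
Let K := merge_class K1 K2.
Let Ksm : smooth K := smooth_merge K1sm K2sm.
Hypothesis FM : filtration K M F.
Variables (n : nat) (phi : formula L2 n.+1) (m : 'I_n -> U).
Hypothesis phi_ex : existential phi.
Let C := definable_set (reductr M) phi m.
Hypothesis Cinf : infinite_set C.

Lemma filtration_reductl : filtration K1 (reductl M) F.
Proof. by split=> [i j /FM.1[]|]; last exact: FM.2. Qed.

Lemma filtration_reductr : filtration K2 (reductr M) F.
Proof. by split=> [i j /FM.1[]|]; last exact: FM.2. Qed.

Lemma embedding_reduct (A B : structure (lang_sum L1 L2) U) f :
  embedding A B f ->
  embedding (reductl A) (reductl B) f /\ embedding (reductr A) (reductr B) f.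
Proof.
move=> [ff fi fr]; split; split=> // r t.
  exact: (fr (inl_symb L2 r)).
exact: (fr (inr_symb L1 r)).
Qed.

Lemma infinite_ambient : infinite_set [set: U].
Proof. by move=> Ufin; apply/Cinf/(sub_finite_set _ Ufin). Qed.

Let F2 := filtration_reductr.

(** Room for [W] in [C]: a stage of the chain contains enough points of [C]
    beyond [F i], together with the witnesses that make [phi] true of them in
    that stage. *)
Lemma definable_points i (W : set U) :
  (forall k, F i (m k)) -> finite_set W ->
  exists j t, [/\ i <= j, set_inj W t,
    forall w, W w -> F j (t w) /\ ~ F i (t w) &
    forall w, W w -> sat (induced (reductr M) (F j)) phi (vcons (t w) m)].
Proof.
move=> mF Wfin.
have Fmono := filtration_mono K2sm F2.
have Ffin : finite_set (F i) := smooth_finite K2sm (filtration_inK K2sm F2 i).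
have [t [ti tC]] := inj_into_infinite Wfin (infinite_setD Cinf Ffin).
have [j0 tF] : exists j, t @` W `<=` F j.
  apply: (filtration_finite K2sm F2); first exact: finite_image.
  by move=> _ [w Ww <-]; have [[]] := tC w Ww.
pose i0 := maxn i j0.
have tF0 w : W w -> F i0 (t w).
  by move=> Ww; apply: Fmono (leq_maxr _ _) _ _; apply: tF; exists w.
have mF0 k : F i0 (m k) by exact: Fmono (leq_maxl _ _) _ (mF k).
have [l lP] : {l : U -> nat & forall w, W w ->
    i0 <= l w /\ sat (induced (reductr M) (F (l w))) phi (vcons (t w) m)}.
  apply: (@choice _ _ (fun w l => W w -> i0 <= l /\
    sat (induced (reductr M) (F l)) phi (vcons (t w) m))) => w.
  have [Ww|nW] := EM (W w); last by exists 0.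
  have [[_ phit] _] := tC w Ww.
  have [|l il lphi] := sat_existential_union Fmono F2.2 phi_ex _ phit (i := i0).
    by apply: vcons_in => //; exact: tF0.
  by exists l.
have [N lN] : exists N, forall w, W w -> l w <= N.
  have [k [a [_ _ Wa]]] := finite_enumeration Wfin.
  exists (\max_(x < k) l (a x)) => w /Wa[x _ <-].
  exact: (leq_bigmax (F := fun x => l (a x)) x).
pose j := maxn i0 N.
have i0j : i0 <= j := leq_maxl _ _.
exists j, t; split=> // [|w Ww|w Ww].
- exact: leq_trans (leq_maxl _ _) i0j.
- have [_ nF] := tC w Ww; split=> //; exact: Fmono i0j _ (tF0 w Ww).
- have [il] := lP w Ww; apply: sat_existential_up => //.
    exact/substructure_induced/Fmono/(leq_trans (lN w Ww) (leq_maxr _ _)).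
  apply: vcons_in => [|k]; first exact: Fmono il _ (tF0 w Ww).
  exact: Fmono il _ (mF0 k).
Qed.

Hypotheses (Mext : extension_property K M).
Hypotheses (K1c : closed_under_substructure K1) (K1AP : dAP K1).
Let F1 := filtration_reductl.

(** A strong extension of [F i] in [K1] comes without L2-structure, so its new
    points may be given that of points of [C] outside [F i]. The extension
    property of [M] then realises them in [C]. The stage [l] records that the
    image is strong in the L1-reduct of [M]. *)
Lemma graft i E : (forall k, F i (m k)) ->
  leK K1 (induced (reductl M) (F i)) E ->
  exists u l, [/\ embedding E (reductl M) u, forall x, F i x -> u x = x,
    forall x, dom E x -> ~ F i x -> C (u x) &
    leK K1 (induced (reductl M) (u @` dom E)) (induced (reductl M) (F l))].
Proof.
move=> mF DE; set D := induced _ _ in DE.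
have DsubE := smooth_sub K1sm DE; have [DK EK] := smooth_in K1sm DE.
pose W := dom E `\` F i.
have Wfin : finite_set W by apply: finite_setD; exact: (smooth_finite K1sm EK).
have [j [t [ij ti tF tphi]]] := definable_points mF Wfin.
have FiFj := filtration_mono K1sm F1 ij.
have [E' [r [EE' re _ rD rI]]] :=
  disjoint_amalgam K1sm infinite_ambient K1AP (F1.1 i j ij) DE.
have EsubE' := smooth_sub K1sm EE'; have [_ E'K] := smooth_in K1sm EE'.
have [t' t't] := injection_retraction ti.
(* [s] copies [F j] into [E'] so that its range contains [E]: the points [t w],
   where [phi] holds, go to the new points [w] of [E], and the others follow
   [r], which is the identity on [F i] and keeps the rest apart from [E]. *)
pose s x := if pselect ((t @` W) x) then t' x else r x.
have st w : W w -> s (t w) = w.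
  by move=> Ww; rewrite /s; case: pselect => [?|[]]; [exact: t't|exists w].
have sr x : ~ (t @` W) x -> s x = r x by rewrite /s; case: pselect.
have sD x : F i x -> s x = x.
  move=> Fx; rewrite sr ?rD// => -[w Ww tw].
  by have [_] := tF w Ww; rewrite tw.
have rW x w : F j x -> ~ (t @` W) x -> W w -> r x <> w.
  move=> Fx ntx [Ew nFw] rxw; apply: nFw.
  suff : dom D w by [].
  by rewrite -rI; split=> //; exists x.
have si : set_inj (F j) s.
  have [_ /set_injP ri _] := re.
  apply/set_injP => x y Fx Fy.
  have [[w Ww <-]|nx] := EM ((t @` W) x);
    have [[w' Ww' <-]|ny] := EM ((t @` W) y).
  - by rewrite !st// => ->.
  - by rewrite st// sr// => /esym /rW-/(_ Fy ny Ww).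
  - by rewrite st// sr// => /rW-/(_ Fx nx Ww').
  - by rewrite !sr//; exact: ri.
pose S := s @` F j.
have SE' : S `<=` dom E'.
  move=> _ [x Fx <-]; have [[w Ww <-]|nx] := EM ((t @` W) x).
    by rewrite st//; case: Ww => /EsubE'.1.
  by rewrite sr//; have [rf _ _] := re; exact: rf.
have ES : dom E `<=` S.
  move=> x Ex; have [Fx|nFx] := EM (F i x).
    by exists x; [exact: FiFj|exact: sD].
  have Wx : W x by [].
  by exists (t x); [exact: (tF x Wx).1|exact: st].
pose N := induced E' S.
have NK : inK K1 N := K1c E'K (induced_substructure SE').
have EN : leK K1 E N.
  apply: (leK_down K1sm EE') => //.
  exact: substructure_common EsubE' (induced_substructure SE') ES.
have DN := smooth_trans K1sm DE EN.
(* The L1-structure comes from [E'] through [s], the L2-structure from [M]. *)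
pose H := superpose (pullback (F j) s N) (induced (reductr M) (F j)).
have Hiso : isomorphism (reductl H) N s.
  exact: pullback_isomorphism (N) si erefl.
have [s' [s'iso s's]] := isomorphism_sym Hiso.
have s'D x : F i x -> s' x = x.
  by move=> Fx; rewrite -{1}(sD x Fx) s's//; exact: FiFj.
have DH : leK K (induced M (F i)) H.
  split; last exact: F2.1.
  exact: (leK_fixing K1sm DN s'iso s'D).
have [h [he hD hs]] :=
  Mext (strong_filtration Ksm FM (FM.1 i i (leqnn i))) DH.
have [l [_ [hl _]]] := strong_le_filtration Ksm FM hs.
have [h1 h2] := embedding_reduct he.
exists (h \o s'), l; split.
- apply: embedding_comp h1.
  exact: (embedding_sub (smooth_sub K1sm EN) s'iso.1).
- by move=> x Fx /=; rewrite s'D// hD.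
- move=> x Ex nFx; have Wx : W x by [].
  rewrite /= -{1}(st x Wx) s's; last exact: (tF x Wx).1.
  have [hf _ _] := h2; split; first exact/hf/(tF x Wx).1.
  have mv k : F j (vcons (t x) m k).
    by apply: vcons_in => [|k']; [exact: (tF x Wx).1|exact: FiFj].
  (* [phi] holds at [t x] in the L2-reduct of [H], which is that of [F j]. *)
  have := (sat_isomorphism (embedding_onto h2) phi mv).1 (tphi x Wx).
  rewrite vcons_comp (_ : h \o m = m); last by apply/funext => k /=; exact: hD.
  apply: sat_existential_up => //.
    exact/induced_substructure/embedding_image.
  apply: vcons_in => /= [|k]; first by exists (t x) => //; exact: (tF x Wx).1.
  by exists (m k); [exact: FiFj|exact: hD].
- apply: smooth_trans K1sm _ _ _ _ hl.
  have := leK_embedding (X := dom E) (Y := dom N) K1sm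
    (embedding_comp s'iso.1 h1) (subset_refl _).
  rewrite -[X in _ -> leK _ _ (induced _ X)]image_comp.
  rewrite (isomorphism_image s'iso); apply=> //.
  exact/(leK_induced K1sm (smooth_sub K1sm EN) (substructure_refl N)).
Qed.

Hypotheses (K1SI : smooth_intersections K1) (K1PS : dPS K1).
Hypothesis mM : forall k, dom M (m k).

Let MC := reductl (induced M C).

Lemma definable_sub : C `<=` dom M.
Proof. by move=> x []. Qed.

Lemma filtration_definable : filtration K1 MC (fun i => F i `&` C).
Proof.
split=> [i j /F1.1|].
  apply: (leK_setI (N := reductl M) K1sm C K1c K1SI).
  exact: (filtration_sub F1).
apply/seteqP; split=> [x Cx|x [i _ []//]].
have := definable_sub Cx; rewrite FM.2 => -[i _ Fx].
by exists i.
Qed.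

(** The amalgam [E] of [B] with [F i] along the trace meets [C], once embedded
    by [graft], exactly in the part [V] that contains [B]; hence the image of
    [B] is strong in some trace [F l `&` C], and so in [C]. *)
Lemma extension_definable : extension_property K1 MC.
Proof.
move=> A B AC AB; have [AK _] := smooth_in K1sm AB.
have Afin := smooth_finite K1sm AK; have [_ AsubC _] := AC.
have [i [AF mF]] : exists i, dom A `<=` F i /\ forall k, F i (m k).
  have [|i1 AF1] := filtration_finite K1sm F1 Afin.
    exact: subset_trans AsubC.1 definable_sub.
  have [||i2 mF2] := filtration_finite K1sm F1 (X := range m).
  - exact/finite_image/finite_finset.
  - by move=> _ [k _ <-]; exact: mM.
  exists (maxn i1 i2); split=> [|k].
    exact: subset_trans AF1 (filtration_mono K1sm F1 (leq_maxl _ _)).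
  by apply: (filtration_mono K1sm F1 (leq_maxr _ _)); apply: mF2; exists k.
pose D := induced (reductl M) (F i).
have CFK := filtration_inK K1sm filtration_definable i.
have ACi : leK K1 A (induced D (F i `&` C)).
  have AsubCi : dom A `<=` F i `&` C.
    by move=> x Ax; split; [exact: AF|exact: AsubC.1].
  apply/(leK_whole K1sm); split=> //; last first.
    apply: (substructure_common (N := MC) (B := induced MC (F i `&` C))
      AsubC _ AsubCi).
    by apply: induced_substructure => x [].
  apply: (strong_le K1sm (strong_in_induced K1sm AC) AsubCi _ CFK) => x [].
  by [].
have [E [g [V [DE ge gA gV [VD EV]]]]] := amalgam_over_trace K1sm
  infinite_ambient K1c K1AP K1PS (filtration_inK K1sm F1 i) (@subIsetl _ _ _)
  ACi AB.
have [u [l [ue uD uC ul]]] := graft mF DE.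
have VE : V `<=` dom E by rewrite EV; exact: subsetUr.
(* Points of [E] outside [V] lie in [D] but not in [C], and [u] fixes them. *)
have uV : u @` V = u @` dom E `&` C.
  apply/seteqP; split=> [_ [x Vx <-]|_ [[x Ex <-] Cux]].
    split; first by exists x => //; exact: VE.
    have [Fx|nFx] := EM (F i x); last exact/uC/nFx/VE.
    rewrite uD//; have : (V `&` dom D) x by [].
    by rewrite VD => -[].
  exists x => //; have [Fx|nFx] := EM (F i x).
    suff [] : (V `&` dom D) x by [].
    by rewrite VD; split=> //; rewrite -(uD x Fx).
  by move: Ex; rewrite EV => -[].
have fB : leK K1 (induced (reductl M) ((u \o g) @` dom B))
                 (induced (reductl M) (F l `&` C)).
  rewrite -image_comp.
  apply: (smooth_trans K1sm (leK_embedding K1sm ue VE gV)).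
  rewrite uV; apply: (leK_setI (N := reductl M) K1sm C K1c K1SI _ ul).
  exact: (filtration_sub F1).
exists (u \o g); split.
- apply: (@embedding_into _ _ B (reductl M)); first exact: embedding_comp ge ue.
  by apply: subset_trans (smooth_sub K1sm fB).1 _ => x [].
- by move=> x Ax /=; rewrite gA// uD//; exact: AF.
- exact: (strong_filtration K1sm filtration_definable (i := l)).
Qed.

End DefinableSet.

Theorem theorem2p12 (L1 L2 : language) (U : Type)
    (K1 : class_data L1 U) (K2 : class_data L2 U)
    (M1 : structure L1 U) (M2 : structure L2 U)
    (Mstar : structure (lang_sum L1 L2) U)
    (n : nat) (phi : formula L2 (S n)) (m : 'I_n -> U) :
  smooth K1 -> smooth K2 ->
  generic K1 M1 -> generic K2 M2 ->
  closed_under_substructure K1 -> closed_under_substructure K2 ->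
  dAP K1 -> dAP K2 ->
  smooth_intersections K1 -> dPS K1 ->
  generic (merge_class K1 K2) Mstar ->
  existential phi ->
  (forall i, dom Mstar (m i)) ->
  let Cstar := definable_set (reductr Mstar) phi m in
  infinite_set Cstar ->
  isomorphic (reductl (induced Mstar Cstar)) M1.
Proof.
move=> K1sm K2sm M1gen _ K1c _ K1AP _ K1SI K1PS Mgen phi_ex mM Cstar Cinf.
have Ksm := smooth_merge K1sm K2sm.
have [F FM] := generic_filtration Ksm Mgen.
have [G GM1] := generic_filtration K1sm M1gen.
have CF := filtration_definable K1sm FM phi m K1c K1SI.
have Cext := extension_definable K1sm K2sm FM phi_ex Cinf
  (generic_extension Ksm Mgen) K1c K1AP K1SI K1PS mM.
exact: (generic_unique K1sm (infinite_ambient Cinf) CF Cext GM1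
  (generic_extension K1sm M1gen)).
Qed.
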